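(* Let $m\in\mathbb{N}$ and let $\lambda=(\lambda_1,\dotsc,\lambda_m)$ and $\mu=(\mu_1,\dotsc,\mu_m)$ be two $m$-tuples of nonnegative integers such that $\lambda\preceq\mu$ ($\lambda$ is majorized by $\mu$). Let $b_n$ denote the Bernoulli numbers of the second kind. Then $$\Biggl|\prod_{\ell=1}^m \lambda_\ell!\,b_{\lambda_\ell+1}\Biggr|\le \Biggl|\prod_{\ell=1}^m \mu_\ell!\,b_{\mu_\ell+1}\Biggr|.$$
   Context: The Bernoulli numbers of the second kind $b_n$, $n\ge 0$, are the real numbers defined by the power series expansion (around $x=0$) $\frac{x}{\ln(1+x)}=\sum_{n=0}^\infty b_nx^n$, where the left-hand side is given its limit value $1$ at $x=0$. Here $\mathbb{N}=\{1,2,3,\dotsc\}$. For $\lambda,\mu\in\mathbb{R}^{m}$, $\lambda$ is majorized by $\mu$ (written $\lambda\preceq\mu$) if $\sum_{\ell=1}^k \lambda_{[\ell]}\le\sum_{\ell=1}^k \mu_{[\ell]}$ for $k=1,2,\dotsc,m-1$ and $\sum_{\ell=1}^m \lambda_\ell=\sum_{\ell=1}^m\mu_\ell$, where $\lambda_{[1]}\ge \lambda_{[2]}\ge \dotsm \ge \lambda_{[m]}$ and $\mu_{[1]}\ge \mu_{[2]}\ge\dotsm \ge \mu_{[m]}$ are the rearrangements of the components of $\lambda$ and $\mu$ in descending order. *)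

(* Defs.v *)
From Stdlib Require Import Reals.
From Coquelicot Require Import Coquelicot.
From mathcomp Require Import all_boot all_order all_algebra Rstruct.

Set Implicit Arguments.
Unset Strict Implicit.
Unset Printing Implicit Defensive.

Import Order.TTheory GRing.Theory Num.Theory.

Local Open Scope R_scope.

(* Stdlib's [ln] is 0 on nonpositive arguments, so these values are
   meaningful only for [-1 < x]; they are used only near 0. *)
Definition x_over_ln1x (x : R) : R :=
  if Req_dec_T x 0 then 1 else x / ln (1 + x).

(* Such a [b] exists, and it is unique because two power series that agree
   near 0 have the same coefficients. *)
Definition bernoulli2 (b : nat -> R) : Prop :=
  locally 0 (fun x : R => is_pseries b x (x_over_ln1x x)).

Local Close Scope R_scope.
Local Open Scope ring_scope.

Definition majorized (F : realDomainType) (m : nat) (x y : m.-tuple F) : Prop :=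
  (forall k : nat, (1 <= k <= m.-1)%N ->
     \sum_(l < k) (sort >=%R x)`_l <= \sum_(l < k) (sort >=%R y)`_l) /\
  \sum_(l < m) tnth x l = \sum_(l < m) tnth y l.

(* Main.v *)
(* The coefficients are $b_n = \int_0^1 \binom{x}{n}\,dx$: integrating
   $\binom{x}{n}' = \sum_k \frac{(-1)^k}{k+1}\binom{x}{n-1-k}$ over $[0,1]$
   gives the recurrence obtained from $\frac{x}{\ln(1+x)}\cdot\ln(1+x) = x$.
   Hence $n!\,|b_{n+1}| = \frac{1}{n+1}\int_0^1 x(1-x)\cdots(n-x)\,dx$, which is
   log-convex in $n$ by the Cauchy-Schwarz inequality, and the theorem is
   Karamata's inequality for the logarithm of this sequence. *)

Require Import Defs.
From HB Require Import structures.
From Stdlib Require Import Reals Lra.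
From Coquelicot Require Import Coquelicot.
From mathcomp Require Import all_boot all_order all_algebra Rstruct.

Set Implicit Arguments.
Unset Strict Implicit.
Unset Printing Implicit Defensive.

Import Order.TTheory GRing.Theory Num.Theory.

Local Open Scope R_scope.

(** * Power series: the recurrence defining the $b_n$ *)

Lemma CV_radius_ge (a : nat -> R) (x : R) :
  ex_pseries a x -> Rbar_le (Rabs x) (CV_radius a).
Proof.
move=> ha; apply: Rbar_not_lt_le => /CV_disk_outside; apply.
apply: ex_series_lim_0; apply: ex_series_ext ha => n.
by rewrite /= pow_n_pow /scal /= /mult /= Rmult_comm.
Qed.

Definition alt_sign (n : nat) : R := (- 1) ^ n.

Lemma is_pseries_alt_sign (x : R) :
  Rabs x < 1 -> is_pseries alt_sign x (/ (1 + x)).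
Proof.
move=> hx; have -> : 1 + x = 1 - (- x) by ring.
apply: (is_series_ext (fun n => (- x) ^ n)); last first.
  by apply: is_series_geom; rewrite Rabs_Ropp.
move=> n; rewrite pow_n_pow /scal /= /mult /= /alt_sign -Rpow_mult_distr.
by congr (_ ^ _); ring.
Qed.

Lemma CV_radius_alt_sign : Rbar_le 1 (CV_radius alt_sign).
Proof.
apply: (proj1 (CV_radius_bounded _)); exists 1 => n.
by rewrite pow1 Rmult_1_r pow_1_abs; exact: Rle_refl.
Qed.

(** Termwise integration of the geometric series for $1/(1+t)$ between 0 and $x$. *)
Lemma is_pseries_ln1p (x : R) :
  Rabs x < 1 -> is_pseries (PS_Int alt_sign) x (ln (1 + x)).
Proof.
move=> hx.
have near0 t : Rmin 0 x <= t <= Rmax 0 x -> Rabs t < 1.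
  move: hx; rewrite /Rmin /Rmax; case: Rle_dec => _; split_Rabs; lra.
suff <- : RInt (PSeries alt_sign) 0 x = ln (1 + x).
  by apply: is_pseries_RInt; apply: Rbar_lt_le_trans CV_radius_alt_sign.
apply: is_RInt_unique.
have -> : ln (1 + x) = minus (ln (1 + x)) (ln (1 + 0)).
  by rewrite Rplus_0_r ln_1; apply/esym; exact: minus_zero_r.
apply: (is_RInt_ext (fun t => / (1 + t))).
  move=> t ht; apply/esym/is_pseries_unique/is_pseries_alt_sign/near0.
  by case: ht => *; split; apply: Rlt_le.
apply: (is_RInt_derive (fun t => ln (1 + t))) => t /near0 ht.
  auto_derive; first by split_Rabs; lra.
  by rewrite Rmult_1_l.
apply: (ex_derive_continuous (fun t => / (1 + t))).
by auto_derive; split_Rabs; lra.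
Qed.

Lemma x_over_ln1x_mul (x : R) : Rabs x < 1 -> x_over_ln1x x * ln (1 + x) = x.
Proof.
move=> hx; rewrite /x_over_ln1x; case: Req_dec_T => /= [->|x0].
  by rewrite Rplus_0_r ln_1; ring.
field; rewrite -ln_1 => /ln_inv h.
by apply: x0; have := h _ _; split_Rabs; lra.
Qed.

(** Near 0 the two series multiply to $\frac{x}{\ln(1+x)}\ln(1+x) = x$, and coefficients of power
    series are unique. *)
Lemma bernoulli2_conv (b : nat -> R) : bernoulli2 b ->
  forall n, PS_mult b (PS_Int alt_sign) n.+1 = if n is 0%nat then 1 else 0.
Proof.
move=> hb n.
(* [PS_incr_1 one] is the series of $x$, with which the product is compared. *)
pose one n := if n is 0%nat then 1 else 0 : R.
have one_series x : is_pseries one x 1.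
  apply: (filterlim_ext (fun _ => 1)); last exact: filterlim_const.
  elim=> [|k IHk]; first by rewrite sum_O /= /scal /= /mult /= Rmult_1_r.
  by rewrite sum_Sn -IHk /one scal_zero_r plus_zero_r.
have ball0E (e x : R) : @ball R_UniformSpace 0 e x = (Rabs x < e).
  by rewrite -[in RHS](Rminus_0_r x).
have [r hr] := hb; have r0 := cond_pos r.
have rad_one : Rbar_lt 0 (CV_radius (PS_incr_1 one)).
  rewrite CV_radius_incr_1; apply: (Rbar_lt_le_trans _ 1); first exact: Rlt_0_1.
  by rewrite -{1}Rabs_R1; apply: CV_radius_ge; exists 1; exact: one_series.
have rad_b : Rbar_le (r / 2) (CV_radius b).
  have hr2 : Rabs (r / 2) = r / 2 by apply: Rabs_pos_eq; lra.
  rewrite -{1}hr2; apply: CV_radius_ge; eexists; apply: hr.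
  by rewrite ball0E hr2; lra.
(* Strictly inside both disks of convergence: the radius is at least $r/2$ for [b] and at least 1
   for the logarithm. *)
pose rho := Rmin (r / 4) (1 / 2).
have rho0 : 0 < rho by apply: Rmin_pos; lra.
have prod_series x : Rabs x <= rho -> is_pseries (PS_mult b (PS_Int alt_sign)) x x.
  move=> hx; have hx1 : Rabs x < 1 by have := Rmin_r (r / 4) (1 / 2); rewrite -/rho; lra.
  have hxr : Rabs x <= r / 4 by have := Rmin_l (r / 4) (1 / 2); rewrite -/rho; lra.
  rewrite -{2}(x_over_ln1x_mul hx1); apply: is_pseries_mult.
  - by apply: hr; rewrite ball0E; lra.
  - exact: is_pseries_ln1p.
  - by apply: Rbar_lt_le_trans rad_b; rewrite /=; lra.
  - by rewrite CV_radius_Int; apply: Rbar_lt_le_trans CV_radius_alt_sign.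
have rad_mult : Rbar_lt 0 (CV_radius (PS_mult b (PS_Int alt_sign))).
  apply: (Rbar_lt_le_trans _ rho) => //.
  rewrite -(Rabs_pos_eq rho); last by lra.
  apply: CV_radius_ge; exists rho; apply: prod_series.
  by rewrite Rabs_pos_eq; lra.
have -> : PS_mult b (PS_Int alt_sign) n.+1 = PS_incr_1 one n.+1.
  apply: PSeries_ext_recip => //.
  exists (mkposreal rho rho0) => x hx.
  rewrite PSeries_incr_1 (is_pseries_unique _ _ _ (one_series x)) Rmult_1_r.
  by apply/is_pseries_unique/prod_series; move: hx; rewrite ball0E /=; lra.
by [].
Qed.

Local Close Scope R_scope.

(* Imported only here because its [ring] and [lra] shadow those of Stdlib. *)
From mathcomp Require Import polyrcf zify ring lra.

(** * Formal integration over $[0,1]$ and binomial polynomials *)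

Local Open Scope ring_scope.

(* The constant coefficient is [p`_0 / 0 = 0]. *)
Definition primp (F : numFieldType) (p : {poly F}) : {poly F} :=
  \poly_(i < (size p).+1) (p`_i.-1 / i%:R).

(** The lower limit contributes nothing, since [primp p] vanishes at 0. *)
Definition int01 (F : numFieldType) (p : {poly F}) : F := (primp p).[1].

Lemma coef_primp (F : numFieldType) (p : {poly F}) (i : nat) :
  (primp p)`_i = p`_i.-1 / i%:R.
Proof.
rewrite coef_poly; case: ltnP => // hi.
by rewrite nth_default ?mul0r // -ltnS (leq_trans hi) ?leqSpred.
Qed.

Lemma deriv_primp (F : numFieldType) (p : {poly F}) : (primp p)^`() = p.
Proof.
apply/polyP => i; rewrite coef_deriv coef_primp /= -[LHS]mulr_natr.
by rewrite divfK // pnatr_eq0.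
Qed.

Lemma int01_is_linear (F : numFieldType) : scalar (@int01 F).
Proof.
move=> a p q; rewrite /int01 -hornerZ -hornerD; congr (_.[1]).
apply/polyP => i; rewrite coefD coefZ !coef_primp coefD coefZ; ring.
Qed.

HB.instance Definition _ (F : numFieldType) :=
  GRing.isLinear.Build F {poly F} F *%R (@int01 F) (@int01_is_linear F).

Lemma int01_deriv (F : numFieldType) (p : {poly F}) :
  int01 p^`() = p.[1] - p.[0].
Proof.
have -> : p.[0] = (p`_0)%:P.[1] by rewrite hornerC horner_coef0.
rewrite /int01 -hornerN -hornerD; congr (_.[1]).
apply/polyP => -[|i]; rewrite coefB coef_primp coefC /=.
  by rewrite invr0 mulr0 subrr.
by rewrite coef_deriv subr0 -[X in X / _]mulr_natr mulfK ?pnatr_eq0.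
Qed.

(** By the mean value theorem the integral equals $p(c)$ for some $c$ in $(0,1)$. *)
Lemma int01_gt0 (F : rcfType) (p : {poly F}) :
  (forall x, 0 < x < 1 -> 0 < p.[x]) -> 0 < int01 p.
Proof.
move=> p_gt0; have [c c01] := poly_mvt (primp p) (@ltr01 F).
rewrite deriv_primp subr0 mulr1 -int01_deriv deriv_primp => ->.
by apply: p_gt0; move: c01; rewrite in_itv.
Qed.

(* [int01 (bprod n)] is $(n+1)!\,|b_{n+1}|$. *)
Definition bprod (F : numFieldType) (n : nat) : {poly F} :=
  'X * \prod_(k < n) (k.+1%:R%:P - 'X).

Definition binp (F : numFieldType) (n : nat) : {poly F} :=
  n`!%:R^-1 *: \prod_(k < n) ('X - k%:R%:P).

Lemma bprodS (F : numFieldType) (n : nat) :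
  bprod F n.+1 = bprod F n * (n.+1%:R%:P - 'X).
Proof. by rewrite /bprod big_ord_recr mulrA. Qed.

Lemma horner_bprodS (F : numFieldType) (n : nat) (x : F) :
  (bprod F n.+1).[x] = (bprod F n).[x] * (n.+1%:R - x).
Proof. by rewrite bprodS hornerM hornerD hornerC hornerN hornerX. Qed.

Lemma bprod_gt0 (F : rcfType) (n : nat) (x : F) :
  0 < x < 1 -> 0 < (bprod F n).[x].
Proof.
move=> /andP[x0 x1]; elim: n => [|n IHn].
  by rewrite /bprod big_ord0 mulr1 hornerX.
by rewrite horner_bprodS mulr_gt0 // subr_gt0 (lt_le_trans x1) ?ler1n.
Qed.

Lemma binp0 (F : numFieldType) : binp F 0 = 1.
Proof. by rewrite /binp big_ord0 fact0 invr1 scale1r. Qed.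

Lemma binpS (F : numFieldType) (n : nat) :
  n.+1%:R *: binp F n.+1 = ('X - n%:R%:P) * binp F n.
Proof.
rewrite /binp big_ord_recr /= factS natrM invfM scalerA mulVKf ?pnatr_eq0 //.
by rewrite -scalerAr mulrC.
Qed.

(** The left side is $x(x-1)\cdots(x-n)$; the sign comes from reversing the $n$ factors other than
    $x$. *)
Lemma binp_bprod (F : numFieldType) (n : nat) :
  n.+1`!%:R *: binp F n.+1 = (-1) ^+ n *: bprod F n.
Proof.
elim: n => [|n IHn].
  by rewrite binpS binp0 /bprod big_ord0 expr0 scale1r subr0.
rewrite factS mulnC natrM -scalerA binpS scalerAr IHn bprodS exprS.
by rewrite -scalerAr mulN1r scaleNr -scalerN -mulrN opprB mulrC.
Qed.

Lemma horner0_binpS (F : numFieldType) (n : nat) : (binp F n.+1).[0] = 0.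
Proof.
by rewrite hornerZ horner_prod big_ord_recl hornerXsubC subrr mul0r mulr0.
Qed.

Lemma horner1_binpSS (F : numFieldType) (n : nat) : (binp F n.+2).[1] = 0.
Proof.
by rewrite hornerZ horner_prod 2!big_ord_recl !hornerXsubC subrr mul0r !mulr0.
Qed.

(* On polynomials, $D = \ln(1 + \Delta)$ and $\Delta\binom{x}{n} = \binom{x}{n-1}$. *)
Lemma deriv_binp (F : numFieldType) (n : nat) :
  (binp F n)^`() = \sum_(k < n) ((-1) ^+ k / k.+1%:R) *: binp F (n - k.+1).
Proof.
elim: n => [|n IHn]; first by rewrite big_ord0 binp0 derivC.
have n1 : n.+1%:R != 0 :> F by rewrite pnatr_eq0.
apply: (scalerI n1); rewrite -derivZ binpS derivM derivB derivX derivC subr0 mul1r.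
rewrite IHn mulr_sumr.
(* Write $X-n = (X-(n-k-1)) - (k+1)$: the first part raises the index by [binpS], the second cancels
   the denominator. *)
have -> : \sum_(k < n) ('X - n%:R%:P) * ((-1) ^+ k / k.+1%:R *: binp F (n - k.+1)) =
  \sum_(k < n) ((-1) ^+ k / k.+1%:R * (n - k)%:R) *: binp F (n - k)
  - \sum_(k < n) (-1) ^+ k *: binp F (n - k.+1).
  rewrite -sumrB; apply: eq_bigr => -[k /= hk] _.
  rewrite -(subnSK hk) -[(_ * _%:R) *: _]scalerA binpS -scalerAr.
  have k1 : k.+1%:R != 0 :> F by rewrite pnatr_eq0.
  rewrite -[X in _ - X *: _](divfK k1) -[(_ * _%:R) *: _]scalerA -scalerBr; congr (_ *: _).
  rewrite -mul_polyC -mulrBl; congr (_ * _).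
  by rewrite natrB // polyCB; ring.
rewrite scaler_sumr addrCA; set S1 := (X in X + _).
(* The added term $k=n$ has the factor $n-k=0$. *)
have -> : S1 = \sum_(k < n.+1) ((-1) ^+ k / k.+1%:R * (n - k)%:R) *: binp F (n - k).
  by rewrite big_ord_recr /= subnn mulr0 scale0r addr0.
have -> : binp F n - \sum_(k < n) (-1) ^+ k *: binp F (n - k.+1) =
  \sum_(k < n.+1) (-1) ^+ k *: binp F (n - k).
  rewrite big_ord_recl expr0 scale1r subn0 -sumrN; congr (_ + _).
  by apply: eq_bigr => k _; rewrite -scaleNr exprS mulN1r.
(* The coefficients agree because $\frac{n-k}{k+1}+1=\frac{n+1}{k+1}$. *)
rewrite -big_split; apply: eq_bigr => -[k /= hk] _; rewrite -scalerDl [RHS]scalerA.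
congr (_ *: _); rewrite natrB //.
have k1 : 1 + k%:R != 0 :> F by rewrite nat1r pnatr_eq0.
by rewrite -![_.+1%:R]natr1; field; rewrite natr1 pnatr_eq0.
Qed.

(** Integrate [deriv_binp] at $n+1$: $\binom{x}{n+1}$ vanishes at 0, and at 1 unless $n=0$. This is
    the recurrence of [bernoulli2_conv]. *)
Lemma int01_binp_conv (F : numFieldType) (n : nat) :
  \sum_(k < n.+1) ((-1) ^+ k / k.+1%:R) * int01 (binp F (n - k)) = (n == 0)%:R.
Proof.
have := int01_deriv (binp F n.+1); rewrite deriv_binp linear_sum horner0_binpS subr0.
under eq_bigr do rewrite linearZ.
move=> ->; case: n => [|n]; last exact: horner1_binpSS.
by have := binpS F 0; rewrite scale1r binp0 subr0 mulr1 => ->; rewrite hornerX.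
Qed.

(** The system is triangular with diagonal entry [a 0], so strong induction determines each value
    from the earlier ones. *)
Lemma conv_unique (F : fieldType) (a u v : nat -> F) : a 0 != 0 ->
  (forall n, \sum_(k < n.+1) a k * u (n - k)%N = \sum_(k < n.+1) a k * v (n - k)%N) ->
  u =1 v.
Proof.
move=> a0 huv n; elim/ltn_ind: n => n IHn.
have := huv n; rewrite !big_ord_recl !subn0 /=.
under eq_bigr => k _ do rewrite IHn ?subnSK ?leq_subr //.
by move/addIr/(mulfI a0).
Qed.

(** * Positivity and log-convexity of [gregory F n], which is $n!\,|b_{n+1}|$ *)

Definition gregory (F : numFieldType) (n : nat) : F := int01 (bprod F n) / n.+1%:R.

Lemma gregory_gt0 (F : rcfType) (n : nat) : 0 < gregory F n.
Proof. by rewrite divr_gt0 ?ltr0n // int01_gt0 // => x; apply: bprod_gt0. Qed.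

Lemma int01_binp_gregory (F : numFieldType) (n : nat) :
  n`!%:R * int01 (binp F n.+1) = (-1) ^+ n * gregory F n.
Proof.
have n1 : n.+1%:R != 0 :> F by rewrite pnatr_eq0.
apply: (mulfI n1); rewrite mulrA -natrM -factS -scalarZ binp_bprod scalarZ.
by rewrite /gregory mulrCA [_ * (_ / _)]mulrC divfK.
Qed.

(* Cauchy-Schwarz for the weight [bprod F n] and the function [n.+1 - x],
   using $(n+1-x)(n+2-x) \ge (n+1-x)^2$. *)
Lemma gregory_logconvex (F : rcfType) (n : nat) :
  gregory F n.+1 ^+ 2 <= gregory F n * gregory F n.+2.
Proof.
set w := int01 (bprod F n); set u := int01 (bprod F n.+1).
set v := int01 (bprod F n.+2).
have w0 : 0 < w by apply: int01_gt0 => x; apply: bprod_gt0.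
have u0 : 0 < u by apply: int01_gt0 => x; apply: bprod_gt0.
(* This value minimizes the quadratic $v-2tu+t^2w$, with minimum $v-u^2/w$. *)
pose t := u / w.
have : 0 < v - 2 * t * u + t ^+ 2 * w.
  rewrite /v /u /w -!scalarZ -linearB -linearD /=.
  apply: int01_gt0 => x hx; have b0 := bprod_gt0 n hx.
  have -> : (bprod F n.+2 - (2 * t) *: bprod F n.+1 + t ^+ 2 *: bprod F n).[x] =
      (bprod F n).[x] * ((n.+1%:R - x - t) ^+ 2 + (n.+1%:R - x)).
    by rewrite !(hornerD, hornerN, hornerZ, horner_bprodS) -!natr1; ring.
  rewrite mulr_gt0 // ltr_wpDl ?sqr_ge0 // subr_gt0.
  by case/andP: hx => _ /lt_le_trans-> //; rewrite ler1n.
have -> : v - 2 * t * u + t ^+ 2 * w = v - u ^+ 2 / w.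
  by rewrite /t; field; rewrite gt_eqF.
rewrite subr_gt0 ltr_pdivrMr // => /ltW huv.
rewrite /gregory expr_div_n mulf_div -/w -/u -/v -natrX -natrM.
rewrite ler_pM ?invr_ge0 ?ler0n ?sqr_ge0 //; first by rewrite mulrC.
(* The denominators contribute $(n+1)(n+3)\le(n+2)^2$. *)
by rewrite lef_pV2 ?posrE ?ltr0n ?muln_gt0 ?expn_gt0 // ler_nat; lia.
Qed.

(** * Karamata's inequality for convex sequences *)

Lemma convex_slope_homo (F : realDomainType) (f : nat -> F) :
  (forall n, f n.+1 *+ 2 <= f n + f n.+2) ->
  {homo (fun n => f n.+1 - f n) : i j / (i <= j)%N >-> i <= j}.
Proof.
move=> f_convex; apply: homo_leq => // [x y z|n]; first exact: le_trans.
by have := f_convex n; lra.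
Qed.

(** The difference $f(y)-f(x)$ telescopes into slopes, which are at least the slope at $x$ to its
    right and at most that slope to its left. *)
Lemma convex_tangent (F : realDomainType) (f : nat -> F) :
  (forall n, f n.+1 *+ 2 <= f n + f n.+2) ->
  forall x y, (f x.+1 - f x) * (y%:R - x%:R) <= f y - f x.
Proof.
move=> /convex_slope_homo slope x y; case: (leqP x y) => [/subnK <-|/ltnW hyx].
  elim: (y - x)%N => [|k IHk]; first by rewrite !subrr mulr0.
  by have := slope x (k + x)%N (leq_addl _ _); rewrite addSn /= -natr1; lra.
have {slope} slope i : (i <= x)%N -> f i.+1 - f i <= f x.+1 - f x by exact: slope.
(* The slope is frozen as [d], so that the induction on [x] moves only the endpoint. *)
move: (f x.+1 - f x) slope hyx => d; elim: x => [|x IHx] slope.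
  by rewrite leqn0 => /eqP ->; rewrite !subrr mulr0.
rewrite leq_eqVlt => /predU1P[->|/IHx]; first by rewrite !subrr mulr0.
have := slope x (leqnSn x).
by move=> h /(_ (fun i hi => slope i (leqW hi))); rewrite -natr1; lra.
Qed.

(** Summation by parts: with $D_k=\sum_{l<k}d_l$, the difference of the two sides is
    $\sum_{k<m}(c_k-c_{k+1})D_{k+1}\ge0$. *)
Lemma abel_sum_ge (F : realDomainType) (c d : nat -> F) (m : nat) :
  (forall k, (k < m)%N -> c k.+1 <= c k) ->
  (forall k, (k <= m)%N -> 0 <= \sum_(l < k) d l) ->
  c m * (\sum_(l < m.+1) d l) <= \sum_(l < m.+1) c l * d l.
Proof.
elim: m => [|m IHm] hc hd; first by rewrite !big_ord1.
rewrite big_ord_recr [leRHS]big_ord_recr /= mulrDr lerD2r.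
apply: le_trans (IHm _ _) => [|k hk|k hk]; last 2 first.
- exact/hc/leqW.
- exact/hd/leqW.
by rewrite ler_wpM2r ?hc ?hd.
Qed.

(** The tangent at $x_l$ gives $f(y_l)-f(x_l)\ge c_l d_l$. The slopes $c_l$ decrease with $x_l$ and
    the $d_l$ sum to 0, so [abel_sum_ge] bounds the total below by 0. *)
Lemma karamata_nat (F : realDomainType) (f : nat -> F) (m : nat) (x y : nat -> nat) :
  (forall n, f n.+1 *+ 2 <= f n + f n.+2) ->
  (forall k, (k.+1 < m)%N -> (x k.+1 <= x k)%N) ->
  (forall k, (k < m)%N -> \sum_(l < k) (x l)%:R <= \sum_(l < k) (y l)%:R :> F) ->
  \sum_(l < m) (x l)%:R = \sum_(l < m) (y l)%:R :> F ->
  \sum_(l < m) f (x l) <= \sum_(l < m) f (y l).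
Proof.
case: m => [|m] f_convex x_dec x_le x_eq; first by rewrite !big_ord0.
pose c l := f (x l).+1 - f (x l); pose d l : F := (y l)%:R - (x l)%:R.
have sumd k : \sum_(l < k) d l = \sum_(l < k) (y l)%:R - \sum_(l < k) (x l)%:R.
  by rewrite sumrB.
have := @abel_sum_ge F c d m; rewrite sumd x_eq subrr mulr0 => /(_ _ _)/le_trans.
rewrite -subr_ge0 -sumrB; apply=> [k hk|k hk|].
- exact/(convex_slope_homo f_convex)/x_dec.
- by rewrite sumd subr_ge0 x_le.
- by apply: ler_sum => l _; apply: convex_tangent.
Qed.

Lemma prod_le_logconvex (g : nat -> R) (m : nat) (x y : nat -> nat) :
  (forall n, 0 < g n) -> (forall n, g n.+1 ^+ 2 <= g n * g n.+2) ->
  (forall k, (k.+1 < m)%N -> (x k.+1 <= x k)%N) ->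
  (forall k, (k < m)%N -> \sum_(l < k) (x l)%:R <= \sum_(l < k) (y l)%:R :> R) ->
  \sum_(l < m) (x l)%:R = \sum_(l < m) (y l)%:R :> R ->
  \prod_(l < m) g (x l) <= \prod_(l < m) g (y l).
Proof.
move=> g0 g_convex x_dec x_le x_eq.
have lnM (u v : R) : 0 < u -> 0 < v -> ln (u * v) = ln u + ln v.
  by move=> /RltP u0 /RltP v0; exact: ln_mult.
have ln_le (u v : R) : 0 < u -> u <= v -> ln u <= ln v.
  by move=> /RltP u0 /RleP uv; apply/RleP; exact: ln_le.
have ln_prod (z : nat -> nat) :
    ln (\prod_(l < m) g (z l)) = \sum_(l < m) ln (g (z l)).
  elim: m {x_dec x_le x_eq} => [|k IHk]; first by rewrite !big_ord0 ln_1.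
  by rewrite !big_ord_recr /= lnM ?IHk // prodr_gt0.
have prod_gt0 (z : nat -> nat) : 0 < \prod_(l < m) g (z l) by exact: prodr_gt0.
(* By contradiction: the strict reverse inequality would pass to the logarithms. *)
have /RltP py0 := prod_gt0 y; rewrite leNgt; apply/negP => /RltP/(ln_increasing _ _ py0).
move/RltP; apply/negP; rewrite -leNgt !ln_prod.
apply: (@karamata_nat _ (ln \o g)) => // n /=.
by rewrite mulr2n -!lnM // ln_le ?mulr_gt0 //; exact: g_convex.
Qed.

(** * Sorted tuples of naturals, and the conclusion *)

Lemma majorized_natP (m : nat) (lam mu : m.-tuple nat) :
  majorized (map_tuple (fun n : nat => n%:R : R) lam)
            (map_tuple (fun n : nat => n%:R : R) mu) ->
  (forall k, (k < m)%N ->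
     \sum_(l < k) (nth 0 (sort geq lam) l)%:R <=
     \sum_(l < k) (nth 0 (sort geq mu) l)%:R :> R) /\
  \sum_(l < m) (nth 0 (sort geq lam) l)%:R =
  \sum_(l < m) (nth 0 (sort geq mu) l)%:R :> R.
Proof.
have sort_cast (s : m.-tuple nat) l :
    (sort >=%R (map_tuple (fun n : nat => n%:R : R) s))`_l =
    (nth 0 (sort geq s) l)%:R.
  (* The cast to [R] preserves and reflects the order, so it commutes with sorting. *)
  have -> : sort >=%R (map_tuple (fun n : nat => n%:R : R) s) =
      [seq n%:R | n <- sort geq s].
    apply: homo_sort_map => [i j /=|j i k /=|i j|i j ij] /=; rewrite ?ler_nat //.
    - by rewrite -eqn_leq eq_sym => /eqP.
    - by move=> hji hkj; apply: leq_trans hkj hji.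
    - exact: leq_total.
  have [hl|hl] := ltnP l (size (sort geq s)); first by rewrite (nth_map 0).
  by rewrite !nth_default ?size_map.
have sum_sort (s : m.-tuple nat) :
    \sum_(l < m) tnth (map_tuple (fun n : nat => n%:R : R) s) l =
    \sum_(l < m) (nth 0 (sort geq s) l)%:R.
  under eq_bigr do rewrite tnth_map.
  rewrite -(big_tuple _ _ s xpredT (fun n : nat => n%:R : R)).
  rewrite -(perm_big _ (permEl (perm_sort geq s))) (big_nth 0) size_sort size_tuple.
  by rewrite big_mkord.
(* The case $k=0$, outside the range in [majorized], is an empty sum. *)
case=> hle; rewrite !sum_sort; split=> // -[|k] hk; first by rewrite !big_ord0.
under eq_bigr do rewrite -sort_cast.
under [leRHS]eq_bigr do rewrite -sort_cast.
by apply: hle; lia.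
Qed.

Lemma prod_sort_tuple (g : nat -> R) (m : nat) (s : m.-tuple nat) :
  \prod_(l < m) g (tnth s l) = \prod_(l < m) g (nth 0 (sort geq s) l).
Proof.
rewrite -(big_tuple _ _ s xpredT g) -(perm_big _ (permEl (perm_sort geq s))).
by rewrite (big_nth 0) size_sort size_tuple big_mkord.
Qed.

(** Both sequences solve the same triangular recurrence, whose leading coefficient is 1. *)
Lemma bernoulli2_int01 (b : nat -> R) : bernoulli2 b ->
  b =1 (fun n => int01 (binp R n)).
Proof.
move=> hb; apply: (@conv_unique _ (fun k => (-1) ^+ k / k.+1%:R)).
  by rewrite expr0 mul1r invr_neq0 ?oner_neq0.
move=> n; rewrite int01_binp_conv.
have := bernoulli2_conv hb n; rewrite /PS_mult sum_f_R0E big_nat_recr //=.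
(* The last term of the Cauchy product drops out, as [PS_Int alt_sign] is 0 at index 0; the rest is
   then summed in reverse order. *)
rewrite big_mkord minusE subnn !RealsE mulr0 addr0 => hn.
transitivity (if n is 0%N then 1 else 0 : R); last by case: (n).
rewrite -hn (reindex_inj rev_ord_inj); apply: eq_bigr => -[k /= hk] _.
rewrite subSS subKn // -[X in PS_Int _ X]/(n.+1 - k)%N subSn // /PS_Int.
by rewrite /alt_sign !RealsE mulrC.
Qed.

Lemma normr_bernoulli2 (b : nat -> R) (n : nat) : bernoulli2 b ->
  `|n`!%:R * b n.+1| = gregory R n.
Proof.
move=> hb; rewrite (bernoulli2_int01 hb) int01_binp_gregory normrM normrX normrN1.
by rewrite expr1n mul1r gtr0_norm ?gregory_gt0.
Qed.

Theorem theorem1p4 (b : nat -> R) (hb : bernoulli2 b)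
  (m : nat) (hm : (0 < m)%N) (lam mu : m.-tuple nat)
  (hmaj : majorized (map_tuple (fun n : nat => n%:R : R) lam)
                    (map_tuple (fun n : nat => n%:R : R) mu)) :
  `| \prod_(l < m) ((tnth lam l)`!%:R * b (tnth lam l).+1) |
  <= `| \prod_(l < m) ((tnth mu l)`!%:R * b (tnth mu l).+1) |.
Proof.
rewrite !normr_prod.
under eq_bigr do rewrite normr_bernoulli2 //.
under [leRHS]eq_bigr do rewrite normr_bernoulli2 //.
(* The products are symmetric, so both tuples may be put in descending order. *)
rewrite !prod_sort_tuple.
have [hle heq] := majorized_natP hmaj.
apply: (prod_le_logconvex _ _ _ hle heq) => [n|n|k hk].
- exact: gregory_gt0.
- exact: gregory_logconvex.
- have geq_total : total geq by move=> i j; exact: leq_total.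
  have geq_trans : transitive geq by move=> i j l ji li; exact: leq_trans li ji.
  apply: (sorted_leq_nth geq_trans leqnn 0 (sort_sorted geq_total lam)) => //;
    by rewrite inE size_sort size_tuple // ltnW.
Qed.
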